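(* Let $p^0,n^0,\rho^f\in\mathcal{C}$ be real grid functions with $\langle p^0-n^0+\rho^f,1\rangle_h=0$, let $\epsilon>0$, and let $\tau>0$ be arbitrary. Let $(p^k,n^k,\phi^k)_{k\ge 0}$ be the solution of the ETD2 scheme with time step $\tau$. Then for every $k\ge 0$, $$\langle p^{k+1},1\rangle_h=\langle p^{k},1\rangle_h=\cdots=\langle p^0,1\rangle_h=:M_p,$$ and $$\langle n^{k+1},1\rangle_h=\langle n^{k},1\rangle_h=\cdots=\langle n^0,1\rangle_h=:M_n.$$
   Context: Let $L>0$, $N\in\mathbb{Z}^+$, $h=L/N$. $\mathcal{C}$ denotes the space of real grid functions $u=(u_{i,j})_{i,j\in\mathbb{Z}}$ that are $N$-periodic in each index (an $N^2$-dimensional space). The discrete inner product is $\langle u,v\rangle_h=h^2\sum_{i,j=1}^N u_{i,j}v_{i,j}$, and $1$ denotes the constant grid function. The discrete Laplacian is $(\Delta_h u)_{i,j}=\frac1{h^2}(u_{i+1,j}+u_{i-1,j}+u_{i,j+1}+u_{i,j-1}-4u_{i,j})$. For $f\in\mathcal{C}$ with $\langle f,1\rangle_h=0$, $(-\epsilon^2\Delta_h)^{-1}f$ denotes the unique $\phi\in\mathcal{C}$ with $-\epsilon^2\Delta_h\phi=f$ and $\langle\phi,1\rangle_h=0$. For $\phi\in\mathcal{C}$, the linear operator $\mathcal{L}_h[\phi]:\mathcal{C}\to\mathcal{C}$ is $$(\mathcal{L}_h[\phi]u)_{i,j}=\frac1{h^2}\sum_{(i',j')}\frac{2e^{\phi_{i',j'}}e^{\phi_{i,j}}}{e^{\phi_{i',j'}}+e^{\phi_{i,j}}}\left(\frac{u_{i',j'}}{e^{\phi_{i',j'}}}-\frac{u_{i,j}}{e^{\phi_{i,j}}}\right),$$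 the sum being over the four neighbours $(i',j')\in\{(i+1,j),(i-1,j),(i,j+1),(i,j-1)\}$. It discretizes $\nabla\cdot(e^{\phi}\nabla(u/e^{\phi}))$. ETD2 scheme (second-order exponential time differencing scheme for the Poisson–Nernst–Planck equations): given $p^0,n^0$, set $\phi^0=(-\epsilon^2\Delta_h)^{-1}(p^0-n^0+\rho^f)$. The first step is $$p^{1}=e^{\tau\mathcal{L}_h[-\phi^0]}p^0,\qquad n^{1}=e^{\tau\mathcal{L}_h[\phi^0]}n^0,\qquad \phi^{1}=(-\epsilon^2\Delta_h)^{-1}(p^{1}-n^{1}+\rho^f),$$ and for $k\ge1$ $$p^{k+1}=e^{2\tau\mathcal{L}_h[-\phi^k]}p^{k-1},\qquad n^{k+1}=e^{2\tau\mathcal{L}_h[\phi^k]}n^{k-1},\qquad \phi^{k+1}=(-\epsilon^2\Delta_h)^{-1}(p^{k+1}-n^{k+1}+\rho^f),$$ where $e^{(\cdot)}$ of an operator is the operator exponential. The scheme is well defined because $p^k-n^k+\rho^f$ has zero mean for every $k$. *)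

(* Defs.v *)
From mathcomp Require Import all_boot all_order all_algebra.
From mathcomp Require Import all_classical all_reals all_analysis.
Set Implicit Arguments.
Unset Strict Implicit.
Unset Printing Implicit Defensive.
Import Order.TTheory GRing.Theory Num.Theory.
Import numFieldNormedType.Exports.
Local Open Scope classical_set_scope.
Local Open Scope ring_scope.

(* A grid function is indexed by all of Z x Z; membership in the N^2-dimensional
   space of N-periodic ones is the predicate [in_C N], which every operator
   below preserves. Sums, opposites and scalings of grid functions are the
   pointwise ones. *)
Notation grid R := (int -> int -> R).

Definition in_C (R : realType) (N : nat) (u : grid R) : Prop :=
  periodic u N%:Z /\ forall i, periodic (u i) N%:Z.

Definition grid1 (R : realType) : grid R := fun _ _ => 1.
Arguments grid1 {R}.

Definition mesh (R : realType) (L : R) (N : nat) : R := L / N%:R.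

Definition dotp (R : realType) (h : R) (N : nat) (u v : grid R) : R :=
  h ^+ 2 * \sum_(1 <= i < N.+1) \sum_(1 <= j < N.+1)
             u i%:Z j%:Z * v i%:Z j%:Z.

Definition lapl (R : realType) (h : R) (u : grid R) : grid R := fun i j =>
  1 / h ^+ 2 *
  (u (i + 1) j + u (i - 1) j + u i (j + 1) + u i (j - 1) - 4 * u i j).

(* (- eps^2 lapl)^-1 f is the unique mean-zero periodic solution [phi] of
   - eps^2 lapl phi = f. It exists whenever f is periodic with zero mean; the
   default value 0 of [xget] is only returned when there is no solution. *)
Definition poisson_sol (R : realType) (h eps : R) (N : nat) (f phi : grid R) :
    Prop :=
  [/\ in_C N phi, - eps ^+ 2 *: lapl h phi = f & dotp h N phi grid1 = 0].

Definition inv_lapl (R : realType) (h eps : R) (N : nat) (f : grid R) : grid R :=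
  xget 0 [set phi | poisson_sol h eps N f phi].

Definition neighbours (i j : int) : seq (int * int) :=
  [:: (i + 1, j); (i - 1, j); (i, j + 1); (i, j - 1)].

Definition Lh (R : realType) (h : R) (phi u : grid R) : grid R := fun i j =>
  1 / h ^+ 2 * \sum_(q <- neighbours i j)
    2 * expR (phi q.1 q.2) * expR (phi i j)
      / (expR (phi q.1 q.2) + expR (phi i j))
    * (u q.1 q.2 / expR (phi q.1 q.2) - u i j / expR (phi i j)).

(* exp(A) u = sum_(k >= 0) A^k u / k!, as a limit taken at each grid point. On
   the finite-dimensional space of periodic grid functions this is the usual
   operator exponential: all notions of convergence agree there. *)
Definition opexp (R : realType) (A : grid R -> grid R) : grid R -> grid R :=
  fun u i j => limn (series (fun k => k`!%:R^-1 * iter k A u i j)).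

Record ETD2_solution (R : realType) (h eps tau : R) (N : nat)
    (p0 n0 rhof : grid R) (p n phi : nat -> grid R) : Prop := {
  ETD2_p0 : p 0%N = p0;
  ETD2_n0 : n 0%N = n0;
  ETD2_phi : forall k, phi k = inv_lapl h eps N (p k - n k + rhof);
  ETD2_p1 : p 1%N = opexp (fun u => tau *: Lh h (- phi 0%N) u) (p 0%N);
  ETD2_n1 : n 1%N = opexp (fun u => tau *: Lh h (phi 0%N) u) (n 0%N);
  ETD2_pS : forall k, (1 <= k)%N ->
    p k.+1 = opexp (fun u => (2 * tau) *: Lh h (- phi k) u) (p k.-1);
  ETD2_nS : forall k, (1 <= k)%N ->
    n k.+1 = opexp (fun u => (2 * tau) *: Lh h (phi k) u) (n k.-1)
}.

(* Main.v *)
Require Import Defs.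
From mathcomp Require Import all_boot all_order all_algebra.
From mathcomp Require Import all_classical all_reals all_analysis.
From mathcomp Require Import ring lra.
Set Implicit Arguments.
Unset Strict Implicit.
Unset Printing Implicit Defensive.
Import Order.TTheory GRing.Theory Num.Theory.
Import numFieldNormedType.Exports.
Local Open Scope classical_set_scope.
Local Open Scope ring_scope.

(** [Lh phi u] is a discrete divergence: the contribution of a neighbour [q] to
    the value at [r] is a flux antisymmetric in [q] and [r], so the sum over one
    period telescopes to 0. Hence every term of exp(t Lh) u beyond the first
    has zero sum. The terms are bounded by |t 16 / h^2|^k sup|u| / k!, so the
    series converges pointwise and its limit commutes with the finite sum over
    one period. *)

Section DiscreteDivergence.
Variables (R : realType) (h : R) (N : nat).
Implicit Types (u phi : grid R).

Definition flux phi u (q r : int * int) : R :=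
  2 * expR (phi q.1 q.2) * expR (phi r.1 r.2)
    / (expR (phi q.1 q.2) + expR (phi r.1 r.2))
  * (u q.1 q.2 / expR (phi q.1 q.2) - u r.1 r.2 / expR (phi r.1 r.2)).

Lemma fluxC phi u q r : flux phi u q r = - flux phi u r q.
Proof.
rewrite /flux -[RHS]mulrN opprB; congr (_ / _ * _); ring.
Qed.

(** Antisymmetry turns the incoming flux from the left and lower neighbours into minus an outgoing
    one. The forms [i - 1 + 1] and [j - 1 + 1] make each bracket a difference of one function at
    consecutive indices, ready to telescope. *)
Lemma Lh_flux phi u i j : Lh h phi u i j = 1 / h ^+ 2 *
  ((flux phi u (i + 1, j) (i, j) - flux phi u (i - 1 + 1, j) (i - 1, j)) +
   (flux phi u (i, j + 1) (i, j) - flux phi u (i, j - 1 + 1) (i, j - 1))).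
Proof.
rewrite /Lh /neighbours !big_cons big_nil addr0 !subrK.
by rewrite -!(fluxC phi u) -!addrA.
Qed.

Lemma flux_le phi u B q r : (forall i j, `|u i j| <= B) ->
  `|flux phi u q r| <= 4 * B.
Proof.
move=> uB; rewrite /flux.
move: (uB q.1 q.2) (uB r.1 r.2) (expR_gt0 (phi q.1 q.2)) (expR_gt0 (phi r.1 r.2)).
move: (u q.1 q.2) (u r.1 r.2) (expR (phi q.1 q.2)) (expR (phi r.1 r.2)) => a b x y aB bB x0 y0.
have xy0 : 0 < x + y by rewrite addr_gt0.
(* The harmonic mean cancels the exponentials in the denominators: what remains is a weighted
   average of [a] and [- b], so the bound does not depend on [phi]. *)
have -> : 2 * x * y / (x + y) * (a / x - b / y) = 2 * (y * a - x * b) / (x + y).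
  by field; rewrite !gt_eqF.
rewrite normrM normfV (gtr0_norm xy0) ler_pdivrMr // normrM ger0_norm //.
have le_xyB : `|y * a - x * b| <= (x + y) * B.
  apply: le_trans (ler_normB _ _) _.
  rewrite !normrM (gtr0_norm x0) (gtr0_norm y0) addrC mulrDl.
  by rewrite lerD // ler_wpM2l // ltW.
have : 0 <= (x + y) * B by apply: le_trans le_xyB.
lra.
Qed.

Lemma Lh_le phi u B : (forall i j, `|u i j| <= B) ->
  forall i j, `|Lh h phi u i j| <= 16 / h ^+ 2 * B.
Proof.
move=> uB i j; rewrite Lh_flux normrM.
have -> : 16 / h ^+ 2 * B = 1 / h ^+ 2 * (4 * B + 4 * B + (4 * B + 4 * B)).
  by ring.
rewrite [`|1 / _|]ger0_norm ?divr_ge0 ?sqr_ge0 //.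
rewrite ler_wpM2l ?divr_ge0 ?sqr_ge0 //.
apply: le_trans (ler_normD _ _) _; apply: lerD;
by apply: le_trans (ler_normB _ _) _; apply: lerD; exact: flux_le.
Qed.

Lemma in_C_Lh phi u : in_C N phi -> in_C N u -> in_C N (Lh h phi u).
Proof.
move=> [p1 p2] [u1 u2]; split=> [i|i j]; last first.
  rewrite /Lh !big_cons !big_nil /= !p2 !u2.
  by rewrite ![j + N%:Z + _]addrAC !p2 !u2.
apply/funext => j; rewrite /Lh !big_cons !big_nil /= !p1 !u1.
by rewrite ![i + N%:Z + _]addrAC !p1 !u1.
Qed.

Lemma sum_periodic_telescope (V : zmodType) (f : int -> V) : periodic f N%:Z ->
  \sum_(1 <= i < N.+1) (f i%:Z - f (i%:Z - 1)) = 0.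
Proof.
move=> fN; rewrite big_add1 /=.
rewrite (telescope_sumr_eq (fun i : nat => f i%:Z)) //.
  by rewrite -[N%:Z]add0r fN subrr.
move=> k _; congr (_ - f _).
by rewrite -addn1 PoszD addrK.
Qed.

Definition gsum u := \sum_(1 <= i < N.+1) \sum_(1 <= j < N.+1) u i%:Z j%:Z.

Lemma gsum_Lh phi u : in_C N phi -> in_C N u -> gsum (Lh h phi u) = 0.
Proof.
move=> [p1 p2] [u1 u2]; rewrite /gsum.
under eq_bigr do (under eq_bigr do rewrite Lh_flux mulrDr).
under eq_bigr do rewrite big_split.
(* Differences in the first index are summed over that index innermost, those in the second index
   over the second; each inner sum then telescopes. *)
rewrite big_split /= exchange_big /=.
rewrite !big1 ?addr0 // => i _; rewrite -mulr_sumr.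
  rewrite (sum_periodic_telescope (f := fun j => flux phi u (i%:Z, j + 1) (i%:Z, j))) ?mulr0 //.
  by move=> j; rewrite /flux /= addrAC !p2 !u2.
rewrite (sum_periodic_telescope (f := fun j => flux phi u (j + 1, i%:Z) (j, i%:Z))) ?mulr0 //.
by move=> j; rewrite /flux /= addrAC !p1 !u1.
Qed.
End DiscreteDivergence.

Section OperatorExponential.
Variables (R : realType) (N : nat).
Implicit Types u : grid R.

Lemma periodicz (U V : zmodType) (f : U -> V) (T : U) : periodic f T ->
  forall (m : int) a, f (a + T *~ m) = f a.
Proof.
move=> fT [] m a; first exact: periodicn.
by rewrite -[LHS](periodicn fT m.+1) NegzE mulrNz subrK.
Qed.

(** The sum of the absolute values over one period dominates each of them, and Euclidean division by
    [N] brings any index back into [0..N-1]. *)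
Lemma in_C_bounded u : (0 < N)%N -> in_C N u ->
  exists B, forall i j, `|u i j| <= B.
Proof.
move=> N0 [u1 u2].
exists (\sum_(i < N) \sum_(j < N) `|u i%:Z j%:Z|).
have red (V : zmodType) (f : int -> V) : periodic f N%:Z ->
    forall i, exists k : 'I_N, f i = f k%:Z.
  move=> fN i; have Nz : 0 < N%:Z by [].
  have := modz_ge0 i (lt0r_neq0 Nz); have := ltz_pmod i Nz.
  have := divz_eq i N%:Z; case: (_ %% _)%Z => // k -> kN _.
  by exists (Ordinal (kN : (k < N)%N)); rewrite addrC mulrC -mulrzz periodicz.
move=> i j; have [a ->] := red _ _ u1 i; have [b ->] := red _ _ (u2 a) j.
rewrite (bigD1 a) //= (bigD1 b) //= -addrA lerDl.
by rewrite addr_ge0 ?sumr_ge0 // => k _; rewrite sumr_ge0.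
Qed.

(** A shift by a period leaves every term of the series unchanged, so both points take the [limn] of
    the same sequence, whether or not it converges. *)
Lemma in_C_opexp (A : grid R -> grid R) u :
  (forall v, in_C N v -> in_C N (A v)) -> in_C N u -> in_C N (opexp A u).
Proof.
move=> A_C uC; have AkC k : in_C N (iter k A u) by elim: k => //= k; exact: A_C.
split=> [i|i j]; [apply/funext => j|];
  rewrite /opexp; congr (limn (series _)); apply/funext => k.
  by rewrite (AkC k).1.
by rewrite (AkC k).2.
Qed.

Lemma is_cvg_opexp (A : grid R -> grid R) (M : R) u :
  (forall v (B : R), (forall a b, `|v a b| <= B) ->
     forall a b, `|A v a b| <= M * B) ->
  (exists B, forall a b, `|u a b| <= B) -> forall i j,
  cvgn (series (fun k => k`!%:R^-1 * iter k A u i j)).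
Proof.
move=> AM [B uB] i j; have AkM k : forall a b, `|iter k A u a b| <= M ^+ k * B.
  elim: k => [|k IH] a b /=; first by rewrite mul1r.
  by rewrite exprS -mulrA; exact: AM.
(* Comparison with [|B|] times the exponential series of [|M|]; the absolute values are there
   because neither [B] nor [M] is assumed nonnegative. *)
apply: normed_cvg; apply: (@series_le_cvg _ _ (fun k => `|B| * exp_coeff `|M| k)) => [k|k|k|].
- exact: normr_ge0.
- by rewrite mulr_ge0 // exp_coeff_ge0.
- rewrite exp_coeffE /= normrM ger0_norm ?invr_ge0 // mulrCA ler_wpM2l ?invr_ge0 //.
  by rewrite -normrX -normrM mulrC (le_trans (AkM _ _ _)) // ler_norm.
- rewrite (_ : series _ = (fun n => `|B| * series (exp_coeff `|M|) n)); last first.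
    by apply/funext => n; rewrite /series /= mulr_sumr.
  by apply: is_cvgMr; exact: is_cvg_series_exp_coeff.
Qed.

Lemma gsum_opexp (A : grid R -> grid R) (M : R) u : (0 < N)%N ->
  (forall v, in_C N v -> in_C N (A v)) ->
  (forall v (B : R), (forall a b, `|v a b| <= B) ->
     forall a b, `|A v a b| <= M * B) ->
  (forall v, in_C N v -> gsum N (A v) = 0) ->
  in_C N u -> gsum N (opexp A u) = gsum N u.
Proof.
move=> N0 A_C AM A0 uC; have AkC k : in_C N (iter k A u) by elim: k => //= k; exact: A_C.
pose S n : grid R := fun i j => series (fun k => k`!%:R^-1 * iter k A u i j) n.
have gS : gsum N (S n) @[n --> \oo] --> gsum N (opexp A u).
  apply: cvg_big => [|i _]; first exact: add_continuous.
  apply: cvg_big => [|j _]; first exact: add_continuous.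
  exact: (is_cvg_opexp AM (in_C_bounded N0 uC)).
(* The sums [gsum N (S n)] are also eventually constant, equal to [gsum N u]; uniqueness of limits
   concludes. *)
apply: (cvg_unique _ gS) => //; apply: cvg_near_cst.
near=> n; have -> : gsum N (S n) = \sum_(0 <= k < n) k`!%:R^-1 * gsum N (iter k A u).
  rewrite /gsum; under eq_bigr do rewrite exchange_big /=.
  rewrite exchange_big; apply: eq_bigr => k _; rewrite mulr_sumr.
  by apply: eq_bigr => i _; rewrite mulr_sumr.
(* The empty partial sum at [n = 0] misses the term [u]. From [n = 1] on that term is present, and
   every later one has the form [A v], with zero sum. *)
have n0 : (0 < n)%N by near: n; exact: nbhs_infty_gt.
rewrite big_ltn // fact0 invr1 mul1r big_nat_cond big1 ?addr0 // => -[|k] //= _.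
by rewrite A0 ?mulr0.
Unshelve. all: by end_near.
Qed.

Lemma ETD_step_gsum (h t : R) (phi u : grid R) : (0 < N)%N -> in_C N phi -> in_C N u ->
  let u' := opexp (fun v => t *: Lh h phi v) u in
  in_C N u' /\ gsum N u' = gsum N u.
Proof.
move=> N0 phiC uC; set A := fun v => t *: Lh h phi v.
have A_C v : in_C N v -> in_C N (A v).
  move=> /(in_C_Lh h phiC) [v1 v2]; split=> [i|i j].
    by apply/funext => j; rewrite /A !fctE v1.
  by rewrite /A !fctE v2.
split; first exact: in_C_opexp.
apply: (gsum_opexp (M := `|t| * (16 / h ^+ 2))) => // v.
- move=> B vB a b; rewrite /A !fctE normrM -mulrA ler_wpM2l //.
  exact: Lh_le.
- move=> vC; rewrite /gsum /A.
  under eq_bigr do (under eq_bigr do rewrite !fctE; rewrite -mulr_sumr).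
  by rewrite -mulr_sumr; have := gsum_Lh h phiC vC; rewrite /gsum => ->; rewrite mulr0.
Qed.

(* The default value 0 of [xget] is periodic, so the Poisson problem need not be
   solvable. *)
Lemma in_C_inv_lapl (h eps : R) (f : grid R) : in_C N (inv_lapl h eps N f).
Proof. by rewrite /inv_lapl; case: xgetP => [phi _ []|_]. Qed.

Lemma in_CN (u : grid R) : in_C N u -> in_C N (- u).
Proof.
move=> [u1 u2]; split=> [i|i j]; last by rewrite !fctE u2.
by apply/funext => j; rewrite !fctE u1.
Qed.

Lemma dotp_grid1 (h : R) u : dotp h N u grid1 = h ^+ 2 * gsum N u.
Proof.
congr (_ * _); apply: eq_bigr => i _; apply: eq_bigr => j _; exact: mulr1.
Qed.

(** Stated for a single species: positive ions use it with [- phi], negative ions with [phi]. *)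
Lemma ETD2_gsum (h tau : R) (u0 : grid R) (u phi : nat -> grid R) :
  (0 < N)%N -> (forall k, in_C N (phi k)) -> in_C N u0 -> u 0%N = u0 ->
  u 1%N = opexp (fun v => tau *: Lh h (phi 0%N) v) (u 0%N) ->
  (forall k, (1 <= k)%N ->
     u k.+1 = opexp (fun v => (2 * tau) *: Lh h (phi k) v) (u k.-1)) ->
  forall k, gsum N (u k) = gsum N u0.
Proof.
move=> N0 phiC u0C u00 u1 uS.
(* The scheme jumps from [k - 1] to [k + 1], so the induction carries two consecutive levels; the
   one-step start supplies level 1. *)
have step k : (in_C N (u k) /\ gsum N (u k) = gsum N u0) /\
              (in_C N (u k.+1) /\ gsum N (u k.+1) = gsum N u0).
  elim: k => [|k [[uC <-] IH]].
    by rewrite u1 u00; split=> //; exact: ETD_step_gsum.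
  by split; rewrite // (uS k.+1) //; exact: ETD_step_gsum.
by move=> k; have [[]] := step k.
Qed.
End OperatorExponential.

Theorem theorem3 (R : realType) (L : R) (N : nat) (eps tau : R)
    (p0 n0 rhof : grid R) (p n phi : nat -> grid R)
    (hL : 0 < L) (hN : (0 < N)%N) (heps : 0 < eps) (htau : 0 < tau)
    (hp0 : in_C N p0) (hn0 : in_C N n0) (hrhof : in_C N rhof)
    (hmean : dotp (mesh L N) N (p0 - n0 + rhof) grid1 = 0)
    (hsol : ETD2_solution (mesh L N) eps tau N p0 n0 rhof p n phi) :
  forall k : nat,
    (dotp (mesh L N) N (p k.+1) grid1 = dotp (mesh L N) N (p k) grid1 /\
     dotp (mesh L N) N (p k) grid1 = dotp (mesh L N) N p0 grid1) /\
    (dotp (mesh L N) N (n k.+1) grid1 = dotp (mesh L N) N (n k) grid1 /\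
     dotp (mesh L N) N (n k) grid1 = dotp (mesh L N) N n0 grid1).
Proof.
case: hsol => p_0 n_0 phiE p1 n1 pS nS.
have phiC k : in_C N (phi k) by rewrite phiE; exact: in_C_inv_lapl.
have pM := ETD2_gsum hN (fun k => in_CN (phiC k)) hp0 p_0 p1 pS.
have nM := ETD2_gsum hN phiC hn0 n_0 n1 nS.
by move=> k; rewrite !dotp_grid1 !pM !nM.
Qed.
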